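(* Let $\Omega$ be a subgraph of a host graph $G$, with nonempty boundary $\partial\Omega$. Suppose that $u_0:\overline{\Omega}\to\mathbb{R}$ satisfies $u_0\ge 0$ and $u_0\not\equiv 0$ on $\Omega$, and that $a,b>0$. Then the problem $$u_t-\Delta_\Omega u=u(a-bu)\ (x\in\Omega,\ t>0),\qquad u=0\ (x\in\partial\Omega,\ t>0),\qquad u(x,0)=u_0(x)\ (x\in\Omega)$$ admits a unique nonnegative global solution $u(x,t)$, and the equilibrium problem $$-\Delta_\Omega u=u(a-bu)\ (x\in\Omega),\qquad u=0\ (x\in\partial\Omega)$$ admits a unique positive solution $u_s(x)$ (positive meaning $u_s>0$ on $\Omega$). Furthermore, let $\lambda_1$ be the least eigenvalue of the Dirichlet eigenvalue problem $-\Delta_\Omega\phi=\lambda\phi$ in $\Omega$, $\phi=0$ on $\partial\Omega$. If $a>\lambda_1$, then $\lim_{t\to+\infty}u(x,t)=u_s(x)$ uniformly for $x\in\overline{\Omega}$; if $a\le\lambda_1$, then $\lim_{t\to+\infty}u(x,t)=0$ uniformly for $x\in\Omega$.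
   Context: The host graph $G=(V,E)$ is finite, undirected and connected, with a weight $\omega:V\times V\to[0,\infty)$ satisfying $\omega_{xy}=\omega_{yx}$ and $\omega_{xy}=0$ if and only if $xy\notin E$, and a measure $\mu:V\to(0,\infty)$. $\Omega$ is an induced, simple, undirected, connected subgraph of $G$ (identified with its vertex set); its boundary is $\partial\Omega=\{z\in V\setminus\Omega: z\sim y\text{ for some }y\in\Omega\}$, where $z\sim y$ means that $z$ and $y$ are joined by an edge, and $\overline{\Omega}=\Omega\cup\partial\Omega$. For $x\in\Omega$, $\Delta_\Omega u(x)=\sum_{y\in\overline{\Omega}}(u(y)-u(x))\frac{\omega_{yx}}{\mu(x)}$; for functions of $(x,t)$ it acts in the variable $x$.
   Formalization: Existence of the positive equilibrium u_s is asserted only when a > λ_1 (its uniqueness for all a, b > 0), since it is false for a ≤ λ_1: with one vertex, one boundary vertex and ω = μ = 1, λ_1 = 1 and u_s = (a−1)/b is not positive if a ≤ 1. *)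

(* Defs.v *)
From HB Require Import structures.
From mathcomp Require Import all_boot all_order all_algebra.
From mathcomp Require Import all_classical all_reals all_analysis.
Set Implicit Arguments.
Unset Strict Implicit.
Unset Printing Implicit Defensive.
Import Order.TTheory GRing.Theory Num.Theory.
Import numFieldNormedType.Exports.
Local Open Scope ring_scope.

Record host_graph (R : realType) (V : finType) (E : rel V)
    (w : V -> V -> R) (mu : V -> R) : Prop := HostGraph {
  host_sym : symmetric E;
  host_connected : forall x y, connect E x y;
  weight_ge0 : forall x y, 0 <= w x y;
  weight_sym : forall x y, w x y = w y x;
  weight_eq0 : forall x y, w x y = 0 <-> ~~ E x y;
  measure_gt0 : forall x, 0 < mu x
}.

(* An induced subgraph is determined by its vertex set Omega: its edges are
   the edges of E with both ends in Omega.  Simple means loopless here, since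
   a relation has no multiple edges. *)
Definition induced_rel (V : finType) (E : rel V) (Omega : {set V}) : rel V :=
  [rel x y | [&& x \in Omega, y \in Omega & E x y]].

Record simple_connected_subgraph (V : finType) (E : rel V) (Omega : {set V}) :
    Prop := SimpleConnectedSubgraph {
  subgraph_simple : {in Omega, forall x, ~~ E x x};
  subgraph_connected :
    {in Omega &, forall x y, connect (induced_rel E Omega) x y}
}.

Definition boundary (V : finType) (E : rel V) (Omega : {set V}) : {set V} :=
  [set z | (z \notin Omega) && [exists y in Omega, E z y]]%SET.

Definition gclosure (V : finType) (E : rel V) (Omega : {set V}) : {set V} :=
  Omega :|: boundary E Omega.

Section Problems.
Variables (R : realType) (V : finType) (E : rel V).
Variables (w : V -> V -> R) (mu : V -> R) (Omega : {set V}).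

(* Functions on the closure of Omega are represented by functions on V whose
   values outside the closure are never used. *)
Definition laplacian (u : V -> R) (x : V) : R :=
  \sum_(y in gclosure E Omega) (u y - u x) * (w y x / mu x).

(* The problem prescribes nothing on the boundary at t = 0 (u0 need not vanish
   there), so this is the set of (x, t) where a solution is determined. *)
Definition space_time (x : V) (t : R) : bool :=
  (x \in Omega) && (0 <= t) || (x \in boundary E Omega) && (0 < t).

(* Continuity on [0, +oo[ ties the evolution for t > 0 to the initial data. *)
Record nonneg_global_solution (a b : R) (u0 : V -> R) (u : V -> R -> R) :
    Prop := NonnegGlobalSolution {
  solution_continuous :
    {in Omega, forall x, ({within `[0, +oo[, continuous (u x)})%classic};
  solution_derivable :
    {in Omega, forall x (t : R), 0 < t -> derivable (u x) t 1};
  solution_equation :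
    {in Omega, forall x (t : R), 0 < t ->
      'D_1 (u x) t - laplacian (u^~ t) x = u x t * (a - b * u x t)};
  solution_boundary :
    {in boundary E Omega, forall x (t : R), 0 < t -> u x t = 0};
  solution_initial : {in Omega, forall x, u x 0 = u0 x};
  solution_ge0 : forall x t, space_time x t -> 0 <= u x t
}.

Record positive_equilibrium (a b : R) (us : V -> R) : Prop :=
    PositiveEquilibrium {
  equilibrium_equation :
    {in Omega, forall x, - laplacian us x = us x * (a - b * us x)};
  equilibrium_boundary : {in boundary E Omega, forall x, us x = 0};
  equilibrium_gt0 : {in Omega, forall x, 0 < us x}
}.

Definition dirichlet_eigenvalue (l : R) : Prop :=
  exists phi : V -> R,
    [/\ exists2 x, x \in Omega & phi x != 0,
        {in Omega, forall x, - laplacian phi x = l * phi x} &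
        {in boundary E Omega, forall x, phi x = 0}].

Definition least_dirichlet_eigenvalue (l : R) : Prop :=
  dirichlet_eigenvalue l /\ forall l', dirichlet_eigenvalue l' -> l <= l'.

End Problems.

(* Main.v *)
Require Import Defs.
From HB Require Import structures.
From mathcomp Require Import all_boot all_order all_algebra.
From mathcomp Require Import all_classical all_reals all_analysis.
From mathcomp Require Import measurable_realfun ring lra.
Set Implicit Arguments.
Unset Strict Implicit.
Unset Printing Implicit Defensive.
Import Order.TTheory GRing.Theory Num.Theory.
Import numFieldNormedType.Exports.
Local Open Scope ring_scope.
Local Open Scope classical_set_scope.

(** Write the problem as u' = F(u) for the finite vector (u x) with x in Omega,
    the values on the boundary being 0.  Everything rests on one structural
    fact: off-diagonal coefficients of F are nonnegative, so the flow and the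
    stationary problem preserve order.

    Existence.  For f between 0 and a constant M >= a / b, the map
    f |-> F(f) + K f is nondecreasing once K is large.  Hence the integral
    equation u(t) = exp(-Kt) (u0 + \int_0^t exp(Ks) (F + K)(u(s)) ds) can be
    iterated from 0: the iterates increase, stay below M, and by dominated
    convergence their limit is a global solution with values in [0, M]
    ([monotone_ode], [bounded_solution]).

    Comparison.  A subsolution that starts below a supersolution stays below:
    at a positive maximum over Omega x [t0, T] of exp(-kt) (s - S), the
    Laplacian of s - S is nonpositive, the reaction contributes at most
    a (s - S), and with k > a the time derivative would be negative
    ([comparison]).  Applied to two solutions in both orders, this is uniqueness.

    Equilibria.  If us and vs are two of them and m = max us / vs > 1 is
    attained at z, then us <= m vs with equality at z; comparing Laplacians at z
    gives us z <= vs z, a contradiction ([equilibrium_le]).  The least eigenvalue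
    has a positive eigenfunction phi: the Rayleigh quotient does not increase
    when f is replaced by |f|, so it has a nonnegative minimiser, an eigenfunction
    that connectedness of Omega makes positive ([principal_eigenfunction]).  When
    lambda_1 < a, a small multiple of phi is a subsolution, and the same monotone
    map iterated downwards from M stops at an equilibrium above it
    ([equilibrium_exists]).

    Asymptotics.  Both limits are squeezed between explicit barriers m(t) psi(x).
    For lambda_1 < a, take psi = us and m(t) = 1 + D exp(-dt): a supersolution for
    D >= 0 and a subsolution for D <= 0.  The lower one needs u > 0 at some time,
    which holds for all t > 0 because positivity spreads along edges
    ([solution_gt0]).  For a <= lambda_1, the quadratic term alone makes
    phi(x) / (c + beta t) a supersolution.  Since Omega is finite, pointwise
    limits are uniform. *)

(** * Scalar linear equations *)

Lemma is_derive_expM (R : realType) (K t : R) :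
  is_derive t 1 (fun s => expR (K * s)) (K * expR (K * t)).
Proof.
have h : is_derive t (1 : R) (fun s : R => K * s) K.
  by apply: is_derive_eq; rewrite /GRing.scale/=; ring.
rewrite mulrC; exact: (@is_derive1_comp _ expR (fun s => K * s)).
Qed.

Lemma continuous_expM (R : realType) (K : R) :
  continuous (fun s : R => expR (K * s)).
Proof.
move=> t; apply: (@continuous_comp _ _ _ (fun s : R => K * s) expR).
  exact: mulrl_continuous.
exact: continuous_expR.
Qed.

Lemma within_continuousM (R : realType) (A : set R) (f g : R -> R) :
    {within A, continuous f} -> {within A, continuous g} ->
  {within A, continuous (f \* g)}.
Proof. by move=> cf cg x; apply: cvgM; [exact: cf | exact: cg]. Qed.

Lemma within_continuousB (R : realType) (A : set R) (f g : R -> R) :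
    {within A, continuous f} -> {within A, continuous g} ->
  {within A, continuous (fun x => f x - g x)}.
Proof. by move=> cf cg x; apply: cvgB; [exact: cf | exact: cg]. Qed.

(** A lower bound for f' + K f bounds f from below whatever the sign of K: the
    integrating factor turns it into a bound for a derivative. *)
Lemma integrating_factor_MVT (R : realType) (K t0 t : R) (f df : R -> R) :
    t0 < t -> {within `[t0, t], continuous f} ->
    (forall s, t0 < s < t -> is_derive s 1 f (df s)) ->
  exists2 c, t0 < c < t & expR (K * t) * f t - expR (K * t0) * f t0
    = expR (K * c) * (df c + K * f c) * (t - t0).
Proof.
move=> lt0t fc fd.
have [s|s|c ct] := @MVT R (fun s => expR (K * s) * f s)
  (fun s => expR (K * s) * (df s + K * f s)) t0 t lt0t.
- rewrite in_itv/= => hs.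
  have h1 := is_derive_expM K s; have h2 := fd s hs.
  apply: is_derive_eq; rewrite /GRing.scale/=; ring.
- apply: within_continuousM => //; apply: continuous_subspaceT.
  exact: continuous_expM.
by move=> ->; exists c => //; rewrite in_itv/= in ct.
Qed.

Lemma integrating_factor_ge0 (R : realType) (K : R) (f df : R -> R) :
    continuous f -> 0 <= f 0 ->
    (forall t : R, 0 < t -> is_derive t 1 f (df t)) ->
    (forall t : R, 0 < t -> 0 <= df t + K * f t) ->
  forall t : R, 0 <= t -> 0 <= f t.
Proof.
move=> cf f0 fd dge t; rewrite le_eqVlt => /predU1P[<-//|t0].
have [|s /andP[s0 _]|c /andP[c0 _]] := @integrating_factor_MVT R K 0 t f df t0.
- exact: continuous_subspaceT.
- exact: fd.
rewrite mulr0 expR0 mul1r => e.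
suff : 0 <= expR (K * t) * f t by rewrite pmulr_rge0// expR_gt0.
have -> : expR (K * t) * f t = expR (K * c) * (df c + K * f c) * (t - 0) + f 0.
  by rewrite -e subrK.
apply: addr_ge0 => //; apply: mulr_ge0; last by rewrite subr0 ltW.
by apply: mulr_ge0; [exact: expR_ge0 | exact: dge].
Qed.

(** The solution of v' = g - K v, v(0) = z, for t >= 0; for t < 0 the integral is
    over an empty interval, which makes the function continuous on the whole line. *)
Definition duhamel (R : realType) (K z : R) (g : R -> R) (t : R) : R :=
  expR (- K * t) *
  (z + parameterized_integral (@lebesgue_measure R) 0 t
         (fun s => expR (K * s) * g s)).

Lemma duhamel0 (R : realType) (K z : R) (g : R -> R) : duhamel K z g 0 = z.
Proof.
rewrite /duhamel mulr0 expR0 mul1r /parameterized_integral set_itv1.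
by rewrite Rintegral_set1 addr0.
Qed.

Lemma continuous_integrable (R : realType) (h : R -> R) (T : R) : continuous h ->
  (@lebesgue_measure R).-integrable `[0, T] (EFin \o h).
Proof.
move=> ch; apply: continuous_compact_integrable; first exact: segment_compact.
exact: continuous_subspaceT.
Qed.

Lemma continuous_integral (R : realType) (h : R -> R) :
    (forall T, (@lebesgue_measure R).-integrable `[0, T] (EFin \o h)) ->
  continuous (fun t => parameterized_integral (@lebesgue_measure R) 0 t h).
Proof.
move=> ih t; have [t0|t0|->] := ltgtP t 0.
- have int0 s : s < 0 -> parameterized_integral (@lebesgue_measure R) 0 s h = 0.
    move=> s0; rewrite /parameterized_integral set_itv_ge ?Rintegral_set0//.
    by rewrite -leNgt bnd_simp.
  rewrite /continuous_at int0//.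
  have c0 : (fun=> 0 : R) @ t --> (0 : R) by apply: cvg_cst.
  apply: cvg_trans c0; apply: near_eq_cvg; near=> s.
  by rewrite int0//; near: s; exact: lt_nbhsl.
- have t1 : 0 < t + 1 by lra.
  have := parameterized_integral_continuous (ltW t1) (ih (t + 1)).
  move=> /(continuous_within_itvP _ t1)[+ _ _]; apply.
  by rewrite in_itv/= t0/=; lra.
- rewrite /continuous_at {2}/parameterized_integral set_itv1 Rintegral_set1.
  exact: (@parameterized_integral_cvg_left R 0 1).
Unshelve. all: by end_near. Qed.

Lemma continuous_duhamel (R : realType) (K z : R) (g : R -> R) :
    (forall T, (@lebesgue_measure R).-integrable `[0, T]
       (EFin \o (fun s => expR (K * s) * g s))) ->
  continuous (duhamel K z g).
Proof.
move=> ig t; apply: cvgM; first exact: continuous_expM.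
by apply: cvgD; [exact: cvg_cst | exact: continuous_integral].
Qed.

Lemma is_derive_duhamel (R : realType) (K z t : R) (g : R -> R) :
    (forall T, (@lebesgue_measure R).-integrable `[0, T]
       (EFin \o (fun s => expR (K * s) * g s))) ->
    0 < t -> {for t, continuous g} ->
  is_derive t 1 (duhamel K z g) (g t - K * duhamel K z g t).
Proof.
move=> ig t0 gt.
have [||dI eI] := @continuous_FTC1_closed R (fun s => expR (K * s) * g s)
  0 t (t + 1) _ (ig _) t0.
- by rewrite ltrDl.
- by apply: cvgM; [exact: continuous_expM | exact: gt].
set I := (fun x => _) in dI eI.
have hI : is_derive t 1 I (expR (K * t) * g t).
  by apply: DeriveDef; [exact: dI | rewrite -derive1E; exact: eI].
have h1 := is_derive_expM (- K) t.
rewrite /duhamel /parameterized_integral -/(I t).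
apply: is_derive_eq; rewrite /GRing.scale/= add0r.
have h : expR (- K * t) * expR (K * t) = 1 by rewrite -expRD mulNr addNr expR0.
have -> : expR (- K * t) * (1 * (expR (K * t) * g t)) = g t.
  by rewrite mul1r mulrA h mul1r.
rewrite -/(I t); ring.
Qed.

(** * Global solutions of monotone systems *)

(** The system u' = G(u) - K u with G nondecreasing on the box between 0 and M,
    G(0) >= 0 and G(M) <= K M, so that the constants 0 and M are a sub- and a
    supersolution. *)
Section MonotoneODE.
Variables (R : realType) (I : Type) (G : (I -> R) -> I -> R) (K M : R).
Hypothesis K0 : 0 <= K.
Hypothesis M0 : 0 <= M.
Hypothesis G_le : forall f g, (forall y, 0 <= f y) -> (forall y, f y <= g y) ->
  (forall y, g y <= M) -> forall x, G f x <= G g x.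
Hypothesis G_bot : forall x, 0 <= G (fun=> 0) x.
Hypothesis G_top : forall x, G (fun=> M) x <= K * M.
Hypothesis G_cvg : forall (T : Type) (F : set_system T) (FF : Filter F)
  (f : T -> I -> R) (l : I -> R),
  (forall y, f t y @[t --> F] --> l y) ->
  forall x, G (f t) x @[t --> F] --> G l x.
Variable z : I -> R.
Hypothesis z_ge0 : forall x, 0 <= z x.
Hypothesis z_leM : forall x, z x <= M.

Fixpoint picard (n : nat) (x : I) : R -> R :=
  if n is n'.+1 then duhamel K (z x) (fun s => G (picard n' ^~ s) x)
  else fun=> 0.

Let integrand n x s := expR (K * s) * G (picard n ^~ s) x.

Let G_continuous n : (forall x, continuous (picard n x)) ->
  forall x, continuous (fun s => G (picard n ^~ s) x).
Proof. by move=> cn x s; apply: G_cvg => y; exact: cn. Qed.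

Let integrand_continuous n x : (forall x, continuous (picard n x)) ->
  continuous (integrand n x).
Proof.
by move=> cn s; apply: cvgM; [exact: continuous_expM | exact: G_continuous].
Qed.

Lemma picard_continuous n x : continuous (picard n x).
Proof.
elim: n x => [|n IH] x /=; first exact: cst_continuous.
apply: continuous_duhamel => T; apply: continuous_integrable.
exact: integrand_continuous.
Qed.

Lemma picard_derive n x (t : R) : 0 < t ->
  is_derive t 1 (picard n.+1 x) (G (picard n ^~ t) x - K * picard n.+1 x t).
Proof.
move=> t0; apply: is_derive_duhamel => //.
  move=> T; apply: continuous_integrable; apply: integrand_continuous.
  exact: picard_continuous.
exact: G_continuous (@picard_continuous n) x t.
Qed.

(** All three bounds propagate together: monotonicity of G only holds inside the
    box, so the order between iterates needs the bounds and conversely. *)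
Lemma picard_monotone_bounded n (t : R) : 0 <= t ->
  forall x, [/\ 0 <= picard n x t, picard n x t <= M
              & picard n x t <= picard n.+1 x t].
Proof.
elim: n t => [|n IH] t t0 x.
  split; [exact: lexx | exact: M0 |].
  have h := @integrating_factor_ge0 R K (picard 1 x)
    (fun s => G (picard 0 ^~ s) x - K * picard 1 x s).
  apply: h t0.
  - exact: picard_continuous.
  - by rewrite /= duhamel0.
  - by move=> s s0; exact: picard_derive.
  - by move=> s s0; rewrite subrK G_bot.
have top y s : 0 <= s -> picard n.+1 y s <= M.
  move=> s0; rewrite -subr_ge0.
  have h := @integrating_factor_ge0 R K (fun r : R => M - picard n.+1 y r)
    (fun r => - (G (picard n ^~ r) y - K * picard n.+1 y r)).
  apply: h s0.
  - by move=> r; apply: cvgB; [exact: cvg_cst | exact: picard_continuous].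
  - by rewrite /= duhamel0 subr_ge0.
  - move=> r r0; have h := picard_derive n y r0.
    by apply: is_derive_eq; rewrite add0r mul1r.
  - move=> r r0.
    have : G (picard n ^~ r) y <= K * M.
      apply: le_trans (G_top y); apply: G_le => // w.
        by have [] := IH r (ltW r0) w.
      by have [] := IH r (ltW r0) w.
    by rewrite mulrBr; lra.
split; [|exact: top|].
  by have [h1 _ h3] := IH t t0 x; exact: le_trans h3.
rewrite -subr_ge0.
have h := @integrating_factor_ge0 R K (fun r : R => picard n.+2 x r - picard n.+1 x r)
    (fun s => (G (picard n.+1 ^~ s) x - K * picard n.+2 x s)
       - (G (picard n ^~ s) x - K * picard n.+1 x s)).
apply: h t0.
- by move=> s; apply: cvgB; exact: picard_continuous.
- by rewrite /= !duhamel0 subrr.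
- move=> s s0; have h1 := picard_derive n x s0.
  have h2 := picard_derive n.+1 x s0.
  exact: is_deriveB.
- move=> s s0.
  have : G (picard n ^~ s) x <= G (picard n.+1 ^~ s) x.
    apply: G_le => y.
    + by have [] := IH s (ltW s0) y.
    + by have [] := IH s (ltW s0) y.
    + exact/top/ltW.
  rewrite mulrBr; lra.
Qed.

Let picard_lim x t := limn (fun n => picard n x t).

Let picard_cvg x t : 0 <= t -> picard n x t @[n --> \oo] --> picard_lim x t.
Proof.
move=> t0; apply: nondecreasing_is_cvgn.
  by apply/nondecreasing_seqP => n; have [] := picard_monotone_bounded n t0 x.
by exists M => _ [n _ <-]; have [] := picard_monotone_bounded n t0 x.
Qed.

(* This formula agrees with the limit of the iterates only for t >= 0, but it
   is continuous on the whole line. *)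
Let solution x := duhamel K (z x) (fun s => G (picard_lim ^~ s) x).

(** Passing to the limit in the integral equation by dominated convergence needs
    no regularity of the limit; its continuity is then read off the equation. *)
Lemma picard_lim_integral T x :
  (@lebesgue_measure R).-integrable `[0, T]
     (EFin \o (fun s => expR (K * s) * G (picard_lim ^~ s) x)) /\
  (0 <= T -> picard n x T @[n --> \oo] --> solution x T).
Proof.
have mf n : measurable_fun `[0, T] (EFin \o integrand n x).
  apply/measurable_EFinP; apply: (@measurable_funS _ _ _ _ setT) => //.
  apply: continuous_measurable_fun; apply: integrand_continuous.
  exact: picard_continuous.
have cf s : `[0, T] s -> (EFin \o integrand n x) s @[n --> \oo] -->
    (EFin \o (fun s => expR (K * s) * G (picard_lim ^~ s) x)) s.
  rewrite /= in_itv/= => /andP[s0 _].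
  apply: cvg_EFin; first by near=> n.
  apply: cvgM; first exact: cvg_cst.
  by apply: G_cvg => y; exact: picard_cvg.
have ig : (@lebesgue_measure R).-integrable `[0, T]
    (EFin \o (cst (expR (K * T) * (K * M)))).
  by apply: continuous_integrable; exact: cst_continuous.
have fg n s : `[0, T] s ->
    (`|(EFin \o integrand n x) s| <= (cst (expR (K * T) * (K * M)) s)%:E)%E.
  rewrite /= in_itv/= => /andP[s0 sT]; rewrite lee_fin.
  have b0 y : 0 <= picard n y s by have [] := picard_monotone_bounded n s0 y.
  have bM y : picard n y s <= M by have [] := picard_monotone_bounded n s0 y.
  have g0 : 0 <= G (picard n ^~ s) x by apply: le_trans (G_bot x) _; apply: G_le.
  have gM : G (picard n ^~ s) x <= K * M by apply: le_trans (G_top x); apply: G_le.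
  rewrite /integrand ger0_norm; last by rewrite mulr_ge0 ?expR_ge0.
  apply: ler_pM => //.
  by rewrite ler_expR ler_wpM2l.
have mh : measurable_fun `[0, T] (EFin \o (fun s => expR (K * s) * G (picard_lim ^~ s) x)).
  exact: (emeasurable_fun_cvg (fun n => EFin \o integrand n x)).
have [||ih _ cvgI] := @dominated_convergence _ (measurableTypeR R) R
    lebesgue_measure _ (measurable_itv _) _ _ _ mf mh _ ig.
- exact: aeW.
- by apply: aeW => s n; exact: fg.
split=> // T0; rewrite -cvg_shiftS/=.
apply: cvgM; first exact: cvg_cst.
apply: cvgD; first exact: cvg_cst.
apply: fine_cvg; rewrite fineK; last exact: integrable_fin_num.
exact: cvgI.
Unshelve. all: by end_near. Qed.

Theorem monotone_ode : exists u : I -> R -> R,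
  [/\ forall x, continuous (u x),
      forall x, u x 0 = z x,
      forall x (t : R), 0 <= t -> 0 <= u x t <= M &
      forall x (t : R), 0 < t ->
        is_derive t 1 (u x) (G (u ^~ t) x - K * u x t)].
Proof.
have solution_lim x t : 0 <= t -> solution x t = picard_lim x t.
  move=> t0; have [_ /(_ t0) h] := picard_lim_integral t x.
  by apply/esym/cvg_lim.
have solution_continuous x : continuous (solution x).
  by apply: continuous_duhamel => T; have [] := picard_lim_integral T x.
exists solution; split; first exact: solution_continuous.
- by move=> x; exact: duhamel0.
- move=> x t t0; rewrite solution_lim//; apply/andP; split.
    apply: limr_ge; first exact: picard_cvg.
    by apply: nearW => n; have [] := picard_monotone_bounded n t0 x.
  apply: limr_le; first exact: picard_cvg.
  by apply: nearW => n; have [] := picard_monotone_bounded n t0 x.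
- move=> x t t0.
  have -> : solution ^~ t = picard_lim ^~ t.
    by apply/funext => y; rewrite solution_lim// ltW.
  apply: is_derive_duhamel => //.
    by move=> T; have [] := picard_lim_integral T x.
  apply: G_cvg => y.
  rewrite -(solution_lim y t (ltW t0)).
  apply: cvg_trans (solution_continuous y t); apply: near_eq_cvg; near=> s.
  by rewrite -solution_lim//; apply: ltW; near: s; exact: lt_nbhsr.
Unshelve. all: by end_near. Qed.
End MonotoneODE.

(** * Auxiliary limits and extrema *)

Lemma cvg_sum_fin (R : realType) (T : Type) (F : set_system T) (I : Type)
    (r : seq I) (P : pred I) (f : I -> T -> R) (l : I -> R) : Filter F ->
  (forall i, P i -> f i t @[t --> F] --> l i) ->
  \sum_(i <- r | P i) f i t @[t --> F] --> \sum_(i <- r | P i) l i.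
Proof. by move=> FF; apply: cvg_big; exact: add_continuous. Qed.

(** Only the left neighbourhood of t enters, so that the maximum over a segment
    may be attained at its right end. *)
Lemma derive_ge0_at_last_max (R : realType) (f : R -> R) (t0 t d : R) :
  t0 < t -> is_derive t 1 f d -> (forall s, t0 <= s <= t -> f s <= f t) -> 0 <= d.
Proof.
move=> t0t [df <-] fmax.
have h := cvg_at_leftE (fun h : R => h^-1 *: ((f \o shift t) (h *: (1:R)) - f t)) 0 df.
rewrite /derive h; apply: limr_ge.
  rewrite -h.
  apply: cvg_trans df; apply: cvg_app.
  move=> A [e egt0 Ae]; exists e => // x xe xgt0; apply: Ae => //.
  exact/ltr0_neq0.
near=> r; apply: mulr_le0.
  by rewrite invr_le0; apply: ltW; near: r; exists 1 => /=.
rewrite subr_le0 /= [_%:A]mulr1; apply: fmax; apply/andP; split.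
  rewrite -lerBlDr; near: r; apply: nbhs_left_ge; lra.
rewrite -lerBrDr subrr; near: r; exact: nbhs_left_le.
Unshelve. all: by end_near. Qed.

(** * The Laplacian and the comparison principle *)

Section Graph.
Variables (R : realType) (V : finType) (E : rel V).
Variables (w : V -> V -> R) (mu : V -> R) (Omega : {set V}).
Hypothesis hG : host_graph E w mu.
Hypothesis hOmega : simple_connected_subgraph E Omega.

Local Notation bd := (boundary E Omega).
Local Notation cl := (gclosure E Omega).
Local Notation L := (laplacian E w mu Omega).

Lemma sub_closure x : x \in Omega -> x \in cl.
Proof. by move=> xO; rewrite !inE xO. Qed.

Lemma closure_cases x : x \in cl -> (x \in Omega) \/ (x \in bd).
Proof. by rewrite /gclosure finset.in_setU => /orP. Qed.

Lemma boundary_notin x : x \in bd -> (x \in Omega) = false.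
Proof. by rewrite inE => /andP[/negbTE]. Qed.

Lemma conductance_ge0 x y : 0 <= w y x / mu x.
Proof.
apply: divr_ge0; first exact: weight_ge0 hG _ _.
exact/ltW/(Defs.measure_gt0 hG _).
Qed.

Lemma weight_gt0 x y : E x y -> 0 < w x y.
Proof.
move=> xy; rewrite lt_neqAle (weight_ge0 hG) andbT; apply/eqP => w0.
by move: (weight_eq0 hG x y) => [/(_ (esym w0))]; rewrite xy.
Qed.

Lemma laplacianZ m f x : L (fun y => m * f y) x = m * L f x.
Proof. by rewrite /laplacian mulr_sumr; apply: eq_bigr => y _; ring. Qed.

Lemma laplacianB f g x : L (fun y => f y - g y) x = L f x - L g x.
Proof. by rewrite /laplacian -sumrB; apply: eq_bigr => y _; ring. Qed.

Lemma eq_laplacian f g x : x \in Omega -> {in cl, f =1 g} -> L f x = L g x.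
Proof.
move=> xO fg; apply: eq_bigr => y yc.
by rewrite (fg _ yc) (fg _ (sub_closure xO)).
Qed.

Lemma laplacian_le f g x : {in cl, forall y, f y <= g y} -> f x = g x ->
  L f x <= L g x.
Proof.
move=> fg fgx; apply: ler_sum => y yc; apply: ler_wpM2r; first exact: conductance_ge0.
by rewrite fgx lerB// fg.
Qed.

Lemma laplacian_max_le0 f x : {in cl, forall y, f y <= f x} -> L f x <= 0.
Proof.
move=> fx; apply: le_trans (laplacian_le fx erefl) _.
by rewrite /laplacian big1// => y _; rewrite subrr mul0r.
Qed.

Definition rate x := \sum_(y in cl) w y x / mu x.

Lemma rate_ge0 x : 0 <= rate x.
Proof. by apply: sumr_ge0 => y _; exact: conductance_ge0. Qed.

(** Boundary terms vanish for Dirichlet data but the diagonal coefficient still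
    counts the edges towards the boundary. *)
Lemma laplacian_dirichlet f x : x \in Omega -> {in bd, forall y, f y = 0} ->
  L f x = \sum_(y in Omega) w y x / mu x * f y - rate x * f x.
Proof.
move=> xO f0; rewrite /rate mulr_suml.
rewrite (_ : \sum_(y in Omega) _ = \sum_(y in cl) w y x / mu x * f y).
  by rewrite -sumrB; apply: eq_bigr => y _; ring.
rewrite [LHS]big_mkcond [RHS]big_mkcond; apply: eq_bigr => y _.
rewrite finset.in_setU; case: ifP => //= _; case: ifP => // yb.
by rewrite f0// mulr0.
Qed.

Lemma sum_weight_le_rate x : \sum_(y in Omega) w y x / mu x <= rate x.
Proof.
rewrite /rate [leLHS]big_mkcond [leRHS]big_mkcond; apply: ler_sum => y _.
rewrite finset.in_setU; case: ifP => //= _; case: ifP => // _; exact: conductance_ge0.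
Qed.

(** The way in which connectedness of Omega is used: a property that passes
    along edges holds everywhere as soon as it holds somewhere. *)
Lemma connected_propagation (P : V -> Prop) x0 : x0 \in Omega -> P x0 ->
  {in Omega &, forall x y, E x y -> P x -> P y} -> {in Omega, forall x, P x}.
Proof.
move=> x0O Px0 step x xO.
have /connectP[p] := subgraph_connected hOmega x0O xO.
elim: p x0 x0O Px0 => [|y p IH] x0 x0O Px0 /=; first by move=> _ ->.
move=> /andP[/and3P[_ yO xy]]; apply: IH => //; exact: step xy Px0.
Qed.

Section Logistic.
Variables (a b : R).
Hypothesis hb : 0 < b.

Local Notation equilibrium := (positive_equilibrium E w mu Omega a b).

(** Concavity of the reaction: u (a - b u) / u decreases in u, so scaling vs by
    m > 1 gives a strict supersolution that cannot touch us from above. *)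
Lemma equilibrium_le us vs : equilibrium us -> equilibrium vs ->
  {in Omega, forall x, us x <= vs x}.
Proof.
move=> hu hv x xO.
have vs0 := equilibrium_gt0 hv; have us0 := equilibrium_gt0 hu.
pose z := [arg max_(y > x in Omega) (us y / vs y)]%O.
have [zO zmax] : z \in Omega /\ {in Omega, forall y, us y / vs y <= us z / vs z}.
  by rewrite /z; case: arg_maxP => // i iO imax; split.
set m := us z / vs z in zmax.
have um y : y \in Omega -> us y <= m * vs y.
  by move=> yO; rewrite -ler_pdivrMr ?vs0// zmax.
have uz : us z = m * vs z by rewrite /m divfK// gt_eqF// vs0.
have m_le1 : m <= 1.
  have le_cl : {in cl, forall y, us y <= m * vs y}.
    move=> y /closure_cases[/um//|yb].
    by rewrite (equilibrium_boundary hu yb) (equilibrium_boundary hv yb) mulr0.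
  have := laplacian_le le_cl uz; rewrite laplacianZ => Lle.
  have eu := equilibrium_equation hu zO; have ev := equilibrium_equation hv zO.
  have : m * (- L vs z) <= - L us z by rewrite mulrN lerN2.
  rewrite eu ev mulrA -uz ler_pM2l ?us0// lerD2l lerN2 ler_pM2l// {1}uz.
  by rewrite -[leRHS]mul1r ler_pM2r ?vs0.
by apply: le_trans (um x xO) _; rewrite ler_piMl// ltW// vs0.
Qed.

(** A subsolution for [cmp := <=%R] and a supersolution for [cmp := >=%R]; a
    solution is a barrier for every reflexive [cmp]. *)
Record barrier (cmp : rel R) (t0 : R) (s : V -> R -> R) : Prop := Barrier {
  barrier_continuous :
    {in Omega, forall x, {within `[t0, +oo[, continuous (s x)}};
  barrier_derivable :
    {in Omega, forall x (t : R), t0 < t -> derivable (s x) t 1};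
  barrier_inequality : {in Omega, forall x (t : R), t0 < t ->
    cmp ('D_1 (s x) t - L (s ^~ t) x) (s x t * (a - b * s x t))};
  barrier_boundary : {in bd, forall x (t : R), t0 < t -> cmp (s x t) 0};
  barrier_ge0 : {in Omega, forall x (t : R), t0 <= t -> 0 <= s x t}
}.

(** The maximum principle.  Nonnegativity of s + S is what makes the quadratic
    term -b (s - S) (s + S) have the favourable sign without any upper bound. *)
Theorem comparison t0 s S : barrier <=%R t0 s -> barrier >=%R t0 S ->
    {in Omega, forall x, s x t0 <= S x t0} ->
  {in Omega, forall x (t : R), t0 <= t -> s x t <= S x t}.
Proof.
move=> hs hS init x xO T t0T.
(* Any k > a does: it beats the linear growth rate of the difference. *)
pose k := a + 1.
pose p y t := expR (- k * t) * (s y t - S y t).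
pose dp y t := expR (- k * t) *
  (('D_1 (s y) t - 'D_1 (S y) t) - k * (s y t - S y t)).
have subT : `[t0, T] `<=` `[t0, +oo[.
  by move=> r; rewrite /= !in_itv/= => /andP[->].
have pc y : y \in Omega -> {within `[t0, T], continuous (p y)}.
  move=> yO; apply: within_continuousM.
    by apply: continuous_subspaceT; exact: continuous_expM.
  apply: within_continuousB.
    exact: continuous_subspaceW subT (barrier_continuous hs yO).
  exact: continuous_subspaceW subT (barrier_continuous hS yO).
have pd y (t : R) : y \in Omega -> t0 < t -> is_derive t 1 (p y) (dp y t).
  move=> yO t0t; have h1 := is_derive_expM (- k) t.
  have h2 := derivableP (barrier_derivable hs yO t0t).
  have h3 := derivableP (barrier_derivable hS yO t0t).
  rewrite /p /dp; apply: is_derive_eq; rewrite /GRing.scale/=; ring.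
(* One maximum in time for each vertex; the largest of them, over the finite
   set Omega, is the maximum over space and time. *)
have argmax y : exists t, y \in Omega ->
    t0 <= t <= T /\ forall r, t0 <= r <= T -> p y r <= p y t.
  case: (boolP (y \in Omega)) => yO; last by exists T.
  have [c cT cmax] := EVT_max t0T (pc y yO); exists c => _.
  by split; [rewrite in_itv in cT | move=> r rT; apply: cmax; rewrite in_itv].
have [tau htau] := choice argmax.
pose z := [arg max_(y > x in Omega) p y (tau y)]%O.
have [zO zmax] : z \in Omega /\ {in Omega, forall y, p y (tau y) <= p z (tau z)}.
  by rewrite /z; case: arg_maxP => // i iO imax; split.
have pmax y r : y \in Omega -> t0 <= r <= T -> p y r <= p z (tau z).
  by move=> yO hr; apply: le_trans (zmax y yO); have [_] := htau y yO; exact.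
have [/andP[t0t tT] _] := htau z zO.
set t := tau z in t0t tT zmax pmax.
have e0 (r : R) : 0 < expR (- k * r) by exact: expR_gt0.
suff pz : p z t <= 0.
  have : p x T <= 0 by apply: le_trans pz; apply: pmax; rewrite // t0T lexx.
  by rewrite /p pmulr_rle0// subr_le0.
rewrite leNgt; apply/negP => pz.
have t0lt : t0 < t.
  rewrite lt_neqAle t0t andbT; apply/eqP => e.
  by move: pz; rewrite /p -e pmulr_rgt0// subr_gt0 ltNge init.
have q0 : 0 < s z t - S z t by rewrite -(pmulr_rgt0 _ (e0 t)).
have : 0 <= dp z t.
  apply: (derive_ge0_at_last_max t0lt (pd z t zO t0lt)) => r /andP[r0 rt].
  by apply: pmax; rewrite // r0 (le_trans rt).
rewrite /dp pmulr_rge0// leNgt => /negP; apply.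
have Lq : L (fun y => s y t - S y t) z <= 0.
  apply: laplacian_max_le0 => y /closure_cases[yO|yb].
    by rewrite -(ler_pM2l (e0 t)); apply: pmax; rewrite // t0t.
  apply: le_trans (ltW q0); rewrite subr_le0.
  apply: le_trans (barrier_boundary hs yb t0lt) _.
  exact: (barrier_boundary hS yb t0lt).
rewrite laplacianB in Lq.
have h1 := barrier_inequality hs zO t0lt.
have h2 : S z t * (a - b * S z t) <= 'D_1 (S z) t - L (S ^~ t) z.
  exact: (barrier_inequality hS zO t0lt).
have s0 := barrier_ge0 hs zO t0t; have S0 := barrier_ge0 hS zO t0t.
have h3 : 0 <= b * (s z t - S z t) * (s z t + S z t).
  by apply: mulr_ge0; [apply: mulr_ge0; exact: ltW | exact: addr_ge0].
by rewrite /k; lra.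
Qed.

Lemma separated_barrier (cmp : rel R) t0 (m dm : R -> R) (psi : V -> R) :
    (forall r, cmp r r) ->
    {in bd, forall x, psi x = 0} -> {in Omega, forall x, 0 <= psi x} ->
    (forall t : R, t0 <= t -> 0 <= m t) ->
    (forall t : R, t0 <= t -> is_derive t 1 m (dm t)) ->
    {in Omega, forall x (t : R), t0 < t ->
      cmp (dm t * psi x - m t * L psi x) (m t * psi x * (a - b * (m t * psi x)))} ->
  barrier cmp t0 (fun x t => m t * psi x).
Proof.
move=> cmp_refl psi0 psi_ge0 m0 md ineq.
have sd x (t : R) : t0 <= t -> is_derive t 1 (fun t => m t * psi x) (dm t * psi x).
  move=> t0t; have h := md t t0t.
  by apply: is_derive_eq; rewrite /GRing.scale/=; ring.
split.
- move=> x xO; apply/subspace_continuousP => t /=; rewrite in_itv/= andbT => t0t.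
  apply: cvg_within_filter; apply: differentiable_continuous.
  by apply/derivable1_diffP; have [] := sd x t t0t.
- by move=> x xO t t0t; have [] := sd x t (ltW t0t).
- move=> x xO t t0t; have [_ ->] := sd x t (ltW t0t).
  by rewrite laplacianZ; exact: ineq.
- by move=> x xb t t0t; rewrite psi0// mulr0.
- by move=> x xO t t0t; rewrite mulr_ge0 ?m0 ?psi_ge0.
Qed.

End Logistic.
End Graph.

(** * A positive eigenfunction for the least eigenvalue *)

Section Principal.
Variables (R : realType) (V : finType) (E : rel V).
Variables (w : V -> V -> R) (mu : V -> R) (Omega : {set V}).
Hypothesis hG : host_graph E w mu.
Hypothesis hOmega : simple_connected_subgraph E Omega.

Local Notation bd := (boundary E Omega).
Local Notation L := (laplacian E w mu Omega).

(** -mu times the Dirichlet Laplacian, as a symmetric matrix on Omega. *)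
Definition stiffness (f : V -> R) x :=
  mu x * rate E w mu Omega x * f x - \sum_(y in Omega) w y x * f y.

Definition energy f := \sum_(x in Omega) f x * stiffness f x.

Definition mass f := \sum_(x in Omega) mu x * f x ^+ 2.

Let mu0 x : 0 < mu x. Proof. exact: Defs.measure_gt0 hG _. Qed.

Lemma mass_ge0 f : 0 <= mass f.
Proof. by apply: sumr_ge0 => x _; rewrite mulr_ge0 ?sqr_ge0// ltW. Qed.

Lemma mass_eq0 f : mass f = 0 -> {in Omega, forall x, f x = 0}.
Proof.
move=> /eqP; rewrite psumr_eq0.
  move=> /allP h x xO; have := h x (mem_index_enum x).
  by rewrite xO/= mulf_eq0 gt_eqF//= sqrf_eq0 => /eqP.
by move=> x _; rewrite mulr_ge0 ?sqr_ge0// ltW.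
Qed.

Lemma stiffnessE f x : x \in Omega -> {in bd, forall y, f y = 0} ->
  stiffness f x = - (mu x * L f x).
Proof.
move=> xO f0; rewrite (laplacian_dirichlet w mu xO f0) /stiffness.
rewrite mulrBr opprB mulrA; congr (_ - _); rewrite mulr_sumr.
by apply: eq_bigr => y _; field; rewrite gt_eqF.
Qed.

Lemma stiffness_lin f g t x :
  stiffness (fun y => f y + t * g y) x = stiffness f x + t * stiffness g x.
Proof.
rewrite /stiffness; set S := \sum_(y in Omega) w y x * (f y + t * g y).
have -> : S = \sum_(y in Omega) w y x * f y + t * \sum_(y in Omega) w y x * g y.
  by rewrite mulr_sumr -big_split; apply: eq_bigr => y _ /=; ring.
ring.
Qed.

Lemma stiffness_sym f g : \sum_(x in Omega) f x * stiffness g x =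
  \sum_(x in Omega) g x * stiffness f x.
Proof.
rewrite /stiffness; under eq_bigr do rewrite mulrBr.
under [RHS]eq_bigr do rewrite mulrBr.
rewrite !sumrB; congr (_ - _); first by apply: eq_bigr => x _; ring.
under eq_bigr do rewrite mulr_sumr.
under [RHS]eq_bigr do rewrite mulr_sumr.
rewrite exchange_big; apply: eq_bigr => x _; apply: eq_bigr => y _.
by rewrite (weight_sym hG x y); ring.
Qed.

Lemma energyZ t f : energy (fun x => t * f x) = t ^+ 2 * energy f.
Proof.
rewrite /energy mulr_sumr; apply: eq_bigr => x _.
have := stiffness_lin (fun=> 0) f t x; rewrite /stiffness.
under eq_bigr do rewrite add0r.
rewrite add0r => ->; rewrite (big1 _ _ (fun y => w y x * 0)).
  by ring.
by move=> y _; rewrite mulr0.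
Qed.

Lemma massZ t f : mass (fun x => t * f x) = t ^+ 2 * mass f.
Proof. by rewrite /mass mulr_sumr; apply: eq_bigr => x _; ring. Qed.

(** The off-diagonal entries are nonpositive and the diagonal part only sees
    squares. *)
Lemma energy_abs f : energy (fun x => `|f x|) <= energy f.
Proof.
apply: ler_sum => x _; rewrite /stiffness !mulrBr; apply: lerB.
  have sqr (r u : R) : u * (r * u) = r * u ^+ 2 by ring.
  by rewrite !sqr real_normK ?num_real.
rewrite !mulr_sumr; apply: ler_sum => y _.
rewrite mulrCA [leRHS]mulrCA; apply: ler_wpM2l; first exact: weight_ge0 hG _ _.
by rewrite -normrM ler_norm.
Qed.

Lemma mass_abs f : mass (fun x => `|f x|) = mass f.
Proof. by apply: eq_bigr => x _; rewrite real_normK ?num_real. Qed.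

Lemma eq_energy f g : {in Omega, f =1 g} -> energy f = energy g.
Proof.
move=> fg; apply: eq_bigr => x xO; rewrite fg// /stiffness fg//; congr (_ * (_ - _)).
by apply: eq_bigr => y yO; rewrite fg.
Qed.

Lemma eq_mass f g : {in Omega, f =1 g} -> mass f = mass g.
Proof. by move=> fg; apply: eq_bigr => x xO; rewrite fg. Qed.

(* The bound 1 + 1 / mu x bounds the value at x in Omega of any function of mass 1,
   since it is at least the square root of 1 / mu x. *)
Let box : set (V -> R) := [set f | forall x, `[0, 1 + (mu x)^-1] (f x)].

Let sphere : set (prod_topology (fun _ : V => R)) := box `&` [set f | mass f = 1].

Lemma coordinate_continuous x : continuous (fun f : prod_topology (fun _ : V => R) => f x).
Proof. exact: proj_continuous. Qed.

Lemma mass_continuous : continuous (mass : prod_topology (fun _ : V => R) -> R).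
Proof.
move=> f; have FF : Filter (nbhs f) by exact: nbhs_filter.
apply: (@cvg_sum_fin R _ _ V _ (mem Omega)
  (fun x (g : prod_topology (fun _ : V => R)) => mu x * g x ^+ 2)
  (fun x => mu x * f x ^+ 2) FF) => x _.
have h := @coordinate_continuous x f.
exact: (cvgM (cvg_cst (mu x)) (cvgM h h)).
Qed.

Lemma energy_continuous : continuous (energy : prod_topology (fun _ : V => R) -> R).
Proof.
move=> f; have FF : Filter (nbhs f) by exact: nbhs_filter.
apply: (@cvg_sum_fin R _ _ V _ (mem Omega)
  (fun x (g : prod_topology (fun _ : V => R)) => g x * stiffness g x)
  (fun x => f x * stiffness f x) FF) => x _.
have h y := @coordinate_continuous y f.
have hs := @cvg_sum_fin R _ _ V (index_enum V) (mem Omega)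
  (fun y (g : prod_topology (fun _ : V => R)) => w y x * g y)
  (fun y => w y x * f y) FF (fun y _ => cvgM (cvg_cst (w y x)) (h y)).
apply: (cvgM (h x)); rewrite /stiffness; apply: cvgB; last exact: hs.
exact: (cvgM (cvg_cst (mu x * rate E w mu Omega x)) (h x)).
Qed.

(** Compactness in the product topology, by Tychonoff's theorem for the box. *)
Lemma nonneg_sphere_compact : compact sphere.
Proof.
apply: compact_closedI.
  apply: (@tychonoff V (fun=> R) (fun x => `[0, 1 + (mu x)^-1]%classic)) => x.
  exact: segment_compact.
apply: (@preimage_closed _ _ (mass : prod_topology (fun _ : V => R) -> R)
  [set x | x = 1]); last exact: closed_eq.
by move=> f _; exact: mass_continuous.
Qed.

Lemma normalize_energy_le f : 0 < mass f -> exists2 g, sphere g &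
  energy g <= (mass f)^-1 * energy f.
Proof.
move=> m0; pose r := (Num.sqrt (mass f))^-1.
have r2 : r ^+ 2 = (mass f)^-1 by rewrite /r exprVn sqr_sqrtr// ltW.
have r0 : 0 <= r by rewrite invr_ge0 sqrtr_ge0.
pose g x := if x \in Omega then r * `|f x| else 0.
have gE : {in Omega, g =1 (fun x => r * `|f x|)} by move=> x xO; rewrite /g xO.
have g0 x : 0 <= g x by rewrite /g; case: ifP => // _; rewrite mulr_ge0.
have mg : mass g = 1.
  by rewrite (eq_mass gE) massZ mass_abs r2 mulVf// gt_eqF.
exists g; last first.
  rewrite (eq_energy gE) energyZ r2; apply: ler_wpM2l; last exact: energy_abs.
  by rewrite invr_ge0 ltW.
split=> // x; rewrite /= in_itv/= g0/=.
case: (boolP (x \in Omega)) => xO; last first.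
  by rewrite /g (negbTE xO) addr_ge0// invr_ge0 ltW.
have : mu x * g x ^+ 2 <= 1.
  rewrite -mg /mass (bigD1 x)//= lerDl sumr_ge0// => y _.
  by rewrite mulr_ge0 ?sqr_ge0// ltW.
rewrite mulrC -ler_pdivlMr// mul1r => h.
have i0 : 0 < (mu x)^-1 by rewrite invr_gt0.
have := g0 x; move: (g x) ((mu x)^-1) h i0 => u v h i0 u0; nra.
Qed.

Lemma rayleigh_minimizer : (exists x, x \in Omega) ->
  exists phi, [/\ forall x, 0 <= phi x, mass phi = 1 &
    forall f, energy phi * mass f <= energy f].
Proof.
move=> [x0 x0O].
have [g sg] : exists g, sphere g.
  have [|g sg _] := @normalize_energy_le (fun=> 1); last by exists g.
  rewrite lt_neqAle mass_ge0 andbT eq_sym; apply/eqP => /mass_eq0 /(_ x0 x0O) /eqP.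
  by rewrite oner_eq0.
have [||phi] := @compact_EVT_min (prod_topology (fun _ : V => R)) R
  energy sphere _ nonneg_sphere_compact.
- by exists g.
- by apply: continuous_subspaceT; exact: energy_continuous.
rewrite inE => -[phi_box m1] phi_min; exists phi; split=> //.
  by move=> x; have := phi_box x; rewrite /= in_itv/= => /andP[].
move=> f; have := mass_ge0 f; rewrite le_eqVlt => /predU1P[m0|m0].
  rewrite -m0 mulr0 /energy big1// => x xO.
  by rewrite (mass_eq0 (esym m0)) ?mul0r.
have [h sh hle] := normalize_energy_le m0.
rewrite -ler_pdivlMr// mulrC; apply: le_trans hle; apply: phi_min.
by rewrite inE.
Qed.

(** The form B below is positive semidefinite and vanishes at (phi, phi), so phi
    is in its radical; evaluating B at (phi, A phi) gives the equation. *)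
Lemma rayleigh_minimizer_eigen phi : mass phi = 1 ->
    (forall f, energy phi * mass f <= energy f) ->
  {in Omega, forall x, stiffness phi x = energy phi * (mu x * phi x)}.
Proof.
move=> m1 phi_min; set l := energy phi in phi_min *.
pose A f x := stiffness f x - l * (mu x * f x).
pose B f g := \sum_(x in Omega) f x * A g x.
have BE f : B f f = energy f - l * mass f.
  rewrite /B /energy /mass mulr_sumr -sumrB; apply: eq_bigr => x _.
  by rewrite /A; ring.
have B_sym f g : B f g = B g f.
  rewrite /B /A; under eq_bigr do rewrite mulrBr.
  under [RHS]eq_bigr do rewrite mulrBr.
  rewrite !sumrB stiffness_sym; congr (_ - _); apply: eq_bigr => x _; ring.
have B_ge0 f : 0 <= B f f by rewrite BE subr_ge0.
have Bphi : B phi phi = 0 by rewrite BE m1 mulr1 subrr.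
have B_quad g t : B (fun y => phi y + t * g y) (fun y => phi y + t * g y) =
    t * (2 * B phi g + t * B g g).
  transitivity (B phi phi + t * B phi g + t * B g phi + t ^+ 2 * B g g).
    rewrite /B !mulr_sumr -!big_split; apply: eq_bigr => x _ /=.
    rewrite /A stiffness_lin; ring.
  by rewrite Bphi (B_sym g phi); ring.
have B0 g : B phi g = 0.
  have q0 := B_ge0 g; set q := B g g in q0; set be := B phi g.
  (* A step t = - be / (q + 1), where q + 1 > 0 even if q = 0, makes the
     quadratic t (2 be + t q) negative unless be = 0. *)
  have := B_ge0 (fun y => phi y + (- be / (q + 1)) * g y).
  rewrite B_quad -/q -/be.
  have -> : - be / (q + 1) * (2 * be + - be / (q + 1) * q) =
      - (be ^+ 2 * ((q + 2) / (q + 1) ^+ 2)) by field; lra.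
  rewrite oppr_ge0 pmulr_lle0; last by rewrite divr_gt0// ?exprn_gt0//; lra.
  by move=> h; apply/eqP; rewrite -sqrf_eq0 eq_le h sqr_ge0.
move=> x xO; apply/eqP; rewrite -subr_eq0 -[_ - _]/(A phi x) -sqrf_eq0.
have /eqP := B0 (A phi); rewrite B_sym /B psumr_eq0.
  by move=> /allP /(_ x (mem_index_enum x)); rewrite xO expr2.
by move=> y _; rewrite -expr2 sqr_ge0.
Qed.

(** The minimum of the Rayleigh quotient is an eigenvalue, and it is below every
    other one; being least characterises it. *)
Lemma principal_eigenfunction l : least_dirichlet_eigenvalue E w mu Omega l ->
  exists phi, [/\ {in Omega, forall x, 0 < phi x},
    {in bd, forall x, phi x = 0} & {in Omega, forall x, - L phi x = l * phi x}].
Proof.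
move=> [[psi [[x0 x0O psi_x0] psi_eq psi_bd]] l_least].
have [|phi' [phi'0 phi'1 phi'_min]] := rayleigh_minimizer; first by exists x0.
pose phi x := if x \in Omega then phi' x else 0.
have phiE : {in Omega, phi =1 phi'} by move=> x xO; rewrite /phi xO.
have phi_ge0 x : 0 <= phi x by rewrite /phi; case: ifP.
have phi1 : mass phi = 1 by rewrite (eq_mass phiE).
have phi_min f : energy phi * mass f <= energy f by rewrite (eq_energy phiE).
have phi_bd : {in bd, forall x, phi x = 0}.
  by move=> x xb; rewrite /phi (boundary_notin xb).
have phi_stiff := rayleigh_minimizer_eigen phi1 phi_min.
have phi_eq : {in Omega, forall x, - L phi x = energy phi * phi x}.
  move=> x xO; have := phi_stiff x xO; rewrite (stiffnessE xO phi_bd) -mulrN.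
  by rewrite mulrCA => /(mulfI (lt0r_neq0 (mu0 x))).
(* If phi vanished at y in Omega, the equation at y would make the weighted sum
   of its neighbours' values vanish. *)
have phi_pos_step : {in Omega &, forall x y, E x y -> 0 < phi x -> 0 < phi y}.
  move=> x y xO yO xy phix; rewrite lt_neqAle phi_ge0 andbT; apply/eqP => phiy.
  have := phi_stiff y yO; rewrite /stiffness -phiy !mulr0 sub0r => /eqP.
  rewrite oppr_eq0 psumr_eq0; last first.
    by move=> z _; rewrite mulr_ge0//; exact: weight_ge0 hG _ _.
  move=> /allP /(_ x (mem_index_enum x)); rewrite xO/= => /eqP h.
  by have := mulr_gt0 (weight_gt0 hG xy) phix; rewrite h ltxx.
have [x1 x1O phix1] : exists2 x, x \in Omega & 0 < phi x.
  apply: contrapT => h; have := phi1; rewrite /mass big1.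
    by move=> /esym/eqP; rewrite oner_eq0.
  move=> x xO; suff -> : phi x = 0 by rewrite expr0n mulr0.
  apply/eqP; rewrite eq_le phi_ge0 andbT leNgt; apply/negP => h'.
  by apply: h; exists x.
have phi_gt0 := connected_propagation hOmega x1O phix1 phi_pos_step.
exists phi; split=> //.
suff -> : l = energy phi by [].
apply/eqP; rewrite eq_le; apply/andP; split.
  apply: l_least; exists phi; split=> //.
  by exists x1 => //; rewrite gt_eqF.
have m0 : 0 < mass psi.
  rewrite lt_neqAle mass_ge0 andbT eq_sym; apply/eqP => /mass_eq0 /(_ x0 x0O).
  exact/eqP.
rewrite -(ler_pM2r m0); apply: le_trans (phi_min psi) _.
rewrite /energy /mass mulr_sumr; apply: ler_sum => x xO.
rewrite (stiffnessE xO psi_bd) -mulrN psi_eq//.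
by rewrite le_eqVlt; apply/orP; left; apply/eqP; ring.
Qed.
End Principal.

(** * Bounds on finite sets *)

Lemma finite_lower_bound (R : realType) (V : finType) (A : {set V}) (f : V -> R) :
  {in A, forall x, 0 < f x} ->
  exists2 e, 0 < e <= 1 & {in A, forall x, e <= f x}.
Proof.
move=> f0; pose S := 1 + \sum_(y in A) (f y)^-1.
have i0 : {in A, forall y, 0 <= (f y)^-1} by move=> y yA; rewrite invr_ge0 ltW// f0.
have S1 : 1 <= S by rewrite lerDl; apply: sumr_ge0 => y yA; exact: i0.
have S0 : 0 < S by apply: lt_le_trans S1.
exists S^-1; first by rewrite invr_gt0 S0 invf_le1.
move=> x xA; rewrite -[leRHS]invrK lef_pV2 ?posrE ?invr_gt0 ?f0//.
rewrite /S (bigD1 x)//= addrCA lerDl addr_ge0// sumr_ge0// => y /andP[yA _].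
exact: i0.
Qed.

Lemma le_sum_nonneg (R : realType) (V : finType) (A : {set V}) (f : V -> R) :
  {in A, forall x, 0 <= f x} -> {in A, forall x, f x <= \sum_(y in A) f y}.
Proof.
move=> f0 x xA; rewrite (bigD1 x)//= lerDl sumr_ge0// => y /andP[yA _].
exact: f0.
Qed.

Lemma cvg_uniform_finite (R : realType) (V : finType) (A : set V)
    (u : V -> R -> R) (us : V -> R) :
  (forall x, A x -> u x t @[t --> +oo] --> us x) ->
  {uniform A, (fun (t : R) (x : V) => u x t) @ +oo --> us}.
Proof.
move=> h P /uniform_nbhs[e [ent_e eP]].
have : \forall t \near +oo, forall x, A x -> e (us x, u x t).
  apply: filter_forall => x; case: (pselect (A x)) => Ax; last exact: nearW.
  have /cvg_entourageP hx := h x Ax.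
  have := hx e ent_e; rewrite near_map; exact: filterS.
apply: filterS => t ht; apply: eP => x Ax; exact: ht.
Qed.

(** * Solutions and equilibria of the logistic problem *)

Section Dynamics.
Variables (R : realType) (V : finType) (E : rel V).
Variables (w : V -> V -> R) (mu : V -> R) (Omega : {set V}) (a b : R).
Hypothesis hG : host_graph E w mu.
Hypothesis hOmega : simple_connected_subgraph E Omega.
Hypotheses (ha : 0 < a) (hb : 0 < b).

Local Notation bd := (boundary E Omega).
Local Notation cl := (gclosure E Omega).
Local Notation L := (laplacian E w mu Omega).
Local Notation rate := (rate E w mu Omega).
Local Notation equilibrium := (positive_equilibrium E w mu Omega a b).
Local Notation solution := (nonneg_global_solution E w mu Omega a b).
Local Notation barrier := (barrier E w mu Omega a b).

(** The right-hand side of the evolution plus K f, for f vanishing on the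
    boundary.  Summing over Omega only makes it insensitive to the values of f
    elsewhere, so it can be iterated on arbitrary functions on V. *)
Definition shifted_rhs K f x :=
  \sum_(y in Omega) w y x / mu x * f y + (K + a - rate x - b * f x) * f x.

(** Large enough that, at every vertex, the diagonal part
    (K + a - rate x) r - b r^2 is nondecreasing for r in [0, M]. *)
Definition shift_constant M := \sum_x rate x + 2 * b * M.

Lemma rate_le_shift (M : R) x : 0 <= M -> rate x + 2 * b * M <= shift_constant M.
Proof.
move=> M0; rewrite /shift_constant lerD2r (bigD1 x)//= lerDl.
by apply: sumr_ge0 => y _; exact: rate_ge0 Omega hG _.
Qed.

Lemma shifted_rhsE K f x : x \in Omega -> {in bd, forall y, f y = 0} ->
  shifted_rhs K f x = L f x + f x * (a - b * f x) + K * f x.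
Proof.
by move=> xO f0; rewrite (laplacian_dirichlet w mu xO f0) /shifted_rhs; ring.
Qed.

Lemma eq_shifted_rhs K f g x : x \in Omega -> {in Omega, f =1 g} ->
  shifted_rhs K f x = shifted_rhs K g x.
Proof.
move=> xO fg; rewrite /shifted_rhs fg//; congr (_ + _).
by apply: eq_bigr => y yO; rewrite fg.
Qed.

Lemma shifted_rhs_le (M : R) (f g : V -> R) x :
  (forall y, 0 <= f y) -> (forall y, f y <= g y) ->
  (forall y, g y <= M) ->
  shifted_rhs (shift_constant M) f x <= shifted_rhs (shift_constant M) g x.
Proof.
move=> f0 fg gM; rewrite /shifted_rhs; apply: lerD.
  by apply: ler_sum => y _; apply: ler_wpM2l => //; exact: conductance_ge0 hG _ _.
have M0 : 0 <= M by apply: le_trans (f0 x) (le_trans (fg x) (gM x)).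
have := rate_le_shift x M0; move: (shift_constant M) => K hK.
rewrite -subr_ge0.
rewrite (_ : _ - _ = (g x - f x) *
  ((K - rate x - 2 * b * M) + a + b * (M - f x) + b * (M - g x))); last by ring.
have h1 : 0 <= b * (M - f x).
  by apply: mulr_ge0; [exact: ltW | rewrite subr_ge0 (le_trans (fg x))].
have h2 : 0 <= b * (M - g x) by apply: mulr_ge0; [exact: ltW | rewrite subr_ge0].
have a0 := ha; by apply: mulr_ge0; [rewrite subr_ge0 | lra].
Qed.

Lemma shifted_rhs_const_le (M K : R) x : a <= b * M -> 0 <= M ->
  shifted_rhs K (fun=> M) x <= K * M.
Proof.
move=> aM M0; rewrite /shifted_rhs -mulr_suml -mulrDl; apply: ler_wpM2r => //.
have := sum_weight_le_rate Omega hG x; lra.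
Qed.

Lemma shifted_rhs_cvg K (T : Type) (F : set_system T) (FF : Filter F)
    (f : T -> V -> R) (l : V -> R) :
    (forall y, f t y @[t --> F] --> l y) ->
  forall x, shifted_rhs K (f t) x @[t --> F] --> shifted_rhs K l x.
Proof.
move=> fl x; apply: cvgD.
  apply: (@cvg_sum_fin R T F V (index_enum V) (mem Omega)
    (fun y t => w y x / mu x * f t y) (fun y => w y x / mu x * l y)) => y _.
  by apply: cvgM; [exact: cvg_cst | exact: fl].
apply: cvgM; last exact: fl.
apply: cvgB; first exact: cvg_cst.
by apply: cvgM; [exact: cvg_cst | exact: fl].
Qed.

(** This is how positivity at a neighbour forces growth. *)
Lemma neighbor_le_shifted_rhs (M : R) (f : V -> R) x :
    (forall y, 0 <= f y) -> (forall y, f y <= M) ->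
  forall y, y \in Omega -> w y x / mu x * f y <= shifted_rhs (shift_constant M) f x.
Proof.
move=> f0 fM y yO; rewrite /shifted_rhs (bigD1 y)//= -addrA lerDl.
have M0 : 0 <= M by apply: le_trans (f0 x) (fM x).
apply: addr_ge0.
  by apply: sumr_ge0 => z _; apply: mulr_ge0 => //; exact: conductance_ge0 hG _ _.
apply: mulr_ge0 => //; have := rate_le_shift x M0.
have h1 : 0 <= b * (M - f x) by apply: mulr_ge0; [exact: ltW | rewrite subr_ge0].
have h2 : 0 <= b * M by apply: mulr_ge0; [exact: ltW | exact: M0].
have a0 := ha; lra.
Qed.

Theorem bounded_solution (M : R) (u0 : V -> R) : 0 <= M -> a <= b * M ->
    {in Omega, forall x, 0 <= u0 x <= M} ->
  exists u, [/\ solution u0 u, forall x (t : R), 0 <= t -> 0 <= u x t <= M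
    & forall x t, x \notin Omega -> u x t = 0].
Proof.
move=> M0 aM hu0; set K := shift_constant M.
have K0 : 0 <= K.
  apply: addr_ge0; first by apply: sumr_ge0 => y _; exact: rate_ge0 Omega hG _.
  by rewrite !mulr_ge0// ltW.
pose z x := if x \in Omega then u0 x else 0.
have hz x : 0 <= z x <= M.
  by rewrite /z; case: ifP => [/hu0//|_]; rewrite lexx.
have shifted_rhs0 x : 0 <= shifted_rhs K (fun=> 0) x.
  by rewrite /shifted_rhs mulr0 addr0 big1// => y _; rewrite mulr0.
have [v [v_cont v_init v_bound v_der]] := @monotone_ode R V (shifted_rhs K) K M K0 M0
  (fun f g f0 fg gM x => shifted_rhs_le x f0 fg gM)
  shifted_rhs0
  (fun x => shifted_rhs_const_le K x aM M0) (@shifted_rhs_cvg K) z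
  (fun x => proj1 (andP (hz x))) (fun x => proj2 (andP (hz x))).
pose u x t := if x \in Omega then v x t else 0.
have uE x : x \in Omega -> u x = v x by move=> xO; apply/funext => t; rewrite /u xO.
have u_out x t : x \notin Omega -> u x t = 0 by rewrite /u => /negbTE ->.
have u_bd x t : x \in bd -> u x t = 0.
  by move=> /boundary_notin xb; rewrite /u xb.
have u_bound x (t : R) : 0 <= t -> 0 <= u x t <= M.
  by move=> t0; rewrite /u; case: ifP => _; [exact: v_bound | rewrite lexx].
exists u; split=> //; split.
- by move=> x xO; rewrite uE//; apply: continuous_subspaceT; exact: v_cont.
- by move=> x xO t t0; rewrite uE//; have [] := v_der x t t0.
- move=> x xO t t0; rewrite uE//; have [_ ->] := v_der x t t0.
  rewrite (_ : shifted_rhs K (v ^~ t) x = shifted_rhs K (u ^~ t) x).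
    by rewrite shifted_rhsE// ?uE//; [ring | move=> y yb; exact: u_bd].
  by apply: eq_shifted_rhs => // y yO; rewrite uE.
- by move=> x xb t _; exact: u_bd.
- by move=> x xO; rewrite uE// v_init /z xO.
- move=> x t /orP[/andP[_ t0]|/andP[xb _]]; last by rewrite u_bd.
  by have /andP[] := u_bound x t t0.
Qed.

Lemma solution_barrier (cmp : rel R) u0 u : (forall r, cmp r r) -> solution u0 u ->
  barrier cmp 0 u.
Proof.
move=> cmp_refl hu; split.
- exact: solution_continuous hu.
- exact: solution_derivable hu.
- by move=> x xO t t0; rewrite (solution_equation hu).
- by move=> x xb t t0; rewrite (solution_boundary hu).
- by move=> x xO t t0; apply: (solution_ge0 hu); rewrite /space_time xO t0.
Qed.

Lemma barrier_later (cmp : rel R) (t0 t1 : R) s :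
  t0 <= t1 -> barrier cmp t0 s -> barrier cmp t1 s.
Proof.
move=> t01 hs; split.
- move=> x xO; apply: continuous_subspaceW (barrier_continuous hs xO) => t.
  by rewrite /= !in_itv/= !andbT; exact: le_trans.
- by move=> x xO t t1t; apply: (barrier_derivable hs) => //; exact: le_lt_trans t1t.
- by move=> x xO t t1t; apply: (barrier_inequality hs) => //; exact: le_lt_trans t1t.
- by move=> x xb t t1t; apply: (barrier_boundary hs) => //; exact: le_lt_trans t1t.
- by move=> x xO t t1t; apply: (barrier_ge0 hs) => //; exact: le_trans t1t.
Qed.

Theorem solution_unique u0 u v : solution u0 u -> solution u0 v ->
  forall x t, space_time E Omega x t -> v x t = u x t.
Proof.
move=> hu hv x t /orP[/andP[xO t0]|/andP[xb t0]]; last first.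
  by rewrite (solution_boundary hu)// (solution_boundary hv).
have le_sol u1 u2 : solution u0 u1 -> solution u0 u2 -> u1 x t <= u2 x t.
  move=> h1 h2.
  apply: (comparison hG hb (@solution_barrier <=%R _ _ lexx h1)
    (@solution_barrier >=%R _ _ lexx h2)) => // y yO.
  by rewrite (solution_initial h1)// (solution_initial h2).
by apply/eqP; rewrite eq_le !le_sol.
Qed.

(** Strong positivity: exp(Kt) u x t has derivative exp(Kt) times the shifted
    right-hand side, which is nonnegative, and positive if a neighbour is. *)
Lemma solution_gt0 (M : R) (u0 : V -> R) (u : V -> R -> R) : solution u0 u ->
    (forall x (t : R), 0 <= t -> 0 <= u x t <= M) ->
    (exists2 x, x \in Omega & 0 < u0 x) ->
  {in Omega, forall x (t : R), 0 < t -> 0 < u x t}.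
Proof.
move=> hu u_bound [x0 x0O ux0]; set K := shift_constant M.
have u0t x (t : R) : 0 <= t -> 0 <= u x t.
  by move=> t0; have /andP[] := u_bound x t t0.
have uMt x (t : R) : 0 <= t -> u x t <= M.
  by move=> t0; have /andP[] := u_bound x t t0.
have growth x (t1 t2 : R) : x \in Omega -> 0 <= t1 -> t1 < t2 ->
    exists2 c, t1 < c < t2 & expR (K * t2) * u x t2 - expR (K * t1) * u x t1
      = expR (K * c) * shifted_rhs K (u ^~ c) x * (t2 - t1).
  move=> xO t1_0 t12.
  have [||c cI ce] := @integrating_factor_MVT R K t1 t2 (u x) (fun t => 'D_1 (u x) t) t12.
  - apply: continuous_subspaceW (solution_continuous hu xO) => t.
    by rewrite /= !in_itv/= andbT => /andP[+ _]; exact: le_trans.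
  - move=> s /andP[s1 _]; apply: derivableP; apply: (solution_derivable hu) => //.
    exact: le_lt_trans s1.
  exists c => //; rewrite ce; congr (_ * _ * _).
  have c0 : 0 < c by case/andP: cI => + _; exact: le_lt_trans.
  rewrite shifted_rhsE//; last by move=> y yb; rewrite (solution_boundary hu).
  by rewrite -(solution_equation hu)//; ring.
have rhs_ge_neighbor x y (t : R) : 0 <= t -> y \in Omega ->
    w y x / mu x * u y t <= shifted_rhs K (u ^~ t) x.
  by move=> t0 yO; apply: neighbor_le_shifted_rhs => // z; [exact: u0t | exact: uMt].
apply: (@connected_propagation V E Omega hOmega
  (fun x => forall t : R, 0 < t -> 0 < u x t) x0 x0O).
  move=> t t0; have [c /andP[c0 _]] := growth x0 0 t x0O (lexx 0) t0.
  rewrite mulr0 expR0 mul1r (solution_initial hu x0O) => e.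
  rewrite -(pmulr_rgt0 _ (expR_gt0 (K * t))).
  have : 0 <= expR (K * c) * shifted_rhs K (u ^~ c) x0 * (t - 0).
    apply: mulr_ge0; last by rewrite subr0 ltW.
    apply: mulr_ge0; first exact: expR_ge0.
    apply: le_trans (rhs_ge_neighbor x0 x0 c (ltW c0) x0O).
    by apply: mulr_ge0; [exact: conductance_ge0 hG _ _ | exact/u0t/ltW].
  rewrite -e; lra.
move=> x y xO yO xy ux t t0.
have h0 : 0 <= t / 2 by lra.
have h1 : t / 2 < t by lra.
have [c /andP[c1 c2] e] := growth y (t / 2) t yO h0 h1.
have c0 : 0 < c by apply: le_lt_trans c1.
rewrite -(pmulr_rgt0 _ (expR_gt0 (K * t))).
have r0 : 0 < expR (K * c) * shifted_rhs K (u ^~ c) y * (t - t / 2).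
  apply: mulr_gt0; last lra.
  apply: mulr_gt0; first exact: expR_gt0.
  apply: lt_le_trans (rhs_ge_neighbor y x c (ltW c0) xO).
  apply: mulr_gt0; last exact: ux.
  by apply: divr_gt0; [exact: weight_gt0 hG _ _ xy | exact: Defs.measure_gt0 hG _].
have q0 : 0 <= expR (K * (t / 2)) * u y (t / 2).
  by apply: mulr_ge0; [exact: expR_ge0 | exact: u0t].
lra.
Qed.

(** Decreasing iteration of f |-> (F(f) + K f) / K from the constant M; the
    subsolution e phi keeps the limit positive. *)
Theorem equilibrium_exists (l : R) : least_dirichlet_eigenvalue E w mu Omega l ->
  l < a -> exists us, equilibrium us.
Proof.
move=> /(principal_eigenfunction hG hOmega)[phi [phi_gt0 phi_bd phi_eq]] la.
have phi_ge0 x : x \in Omega -> 0 <= phi x by move=> /phi_gt0/ltW.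
set B := 1 + \sum_(y in Omega) phi y.
have B0 : 0 < B by apply: ltr_pwDl => //; exact: sumr_ge0.
have phiB x : x \in Omega -> phi x <= B.
  move=> xO; apply: le_trans (le_sum_nonneg phi_ge0 xO) _.
  by rewrite lerDr ler01.
(* The choice of e gives b e phi <= a - l, which makes e phi a subsolution, and
   that of M gives both a <= b M and e phi <= M. *)
pose e := (a - l) / (b * B); pose M := a / b + (a - l) / b.
have ab0 : 0 < a / b by exact: divr_gt0.
have al0 : 0 < (a - l) / b by apply: divr_gt0 => //; lra.
have M0 : 0 < M by rewrite /M; lra.
have aM : a <= b * M.
  have -> : b * M = a + (a - l) by rewrite /M; field; rewrite gt_eqF.
  by lra.
have e0 : 0 < e by apply: divr_gt0; [lra | exact: mulr_gt0].
have eB : e * B = (a - l) / b by rewrite /e; field; rewrite !gt_eqF.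
pose low x := if x \in Omega then e * phi x else 0.
have lowE x : x \in Omega -> low x = e * phi x by move=> xO; rewrite /low xO.
have low_bd : {in bd, forall x, low x = 0}.
  by move=> x /boundary_notin xb; rewrite /low xb.
have low_ge0 x : 0 <= low x.
  by rewrite /low; case: ifP => // xO; apply: mulr_ge0; [exact: ltW | exact: phi_ge0].
have low_le x : low x <= (a - l) / b.
  rewrite /low; case: ifP => [xO|_]; last exact: ltW.
  by rewrite -eB ler_pM2l// phiB.
have lowM x : low x <= M by apply: le_trans (low_le x) _; rewrite lerDr ltW.
set K := shift_constant M.
have K0 : 0 < K.
  apply: ltr_wpDl; first by apply: sumr_ge0 => y _; exact: rate_ge0 Omega hG _.
  by rewrite !mulr_gt0.
pose T f x := K^-1 * shifted_rhs K f x.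
have T_le f g : (forall y, 0 <= f y) -> (forall y, f y <= g y) ->
    (forall y, g y <= M) -> forall x, T f x <= T g x.
  move=> f0 fg gM x; apply: ler_wpM2l; first by rewrite invr_ge0 ltW.
  exact: shifted_rhs_le.
have T_low x : low x <= T low x.
  rewrite /T mulrC ler_pdivlMr// mulrC.
  case: (boolP (x \in Omega)) => xO; last first.
    rewrite {1}/low (negbTE xO) mulr0.
    apply: le_trans (shifted_rhs_le x (fun y => lexx 0) low_ge0 lowM).
    by rewrite /shifted_rhs mulr0 addr0 big1// => y _; rewrite mulr0.
  rewrite shifted_rhsE// lerDr.
  have -> : L low x = - (l * low x).
    rewrite (@eq_laplacian _ _ _ w mu _ low (fun y => e * phi y) x xO).
      by rewrite laplacianZ lowE// -[L phi x]opprK phi_eq//; ring.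
    move=> y /closure_cases[yO|yb]; first exact: lowE.
    by rewrite low_bd// phi_bd// mulr0.
  have hv : b * low x <= a - l.
    rewrite -ler_pdivlMl// mulrC; exact: low_le.
  rewrite (_ : _ + _ = low x * (a - l - b * low x)); last by ring.
  by apply: mulr_ge0 => //; lra.
have T_M x : T (fun=> M) x <= M.
  rewrite /T mulrC ler_pdivrMr// mulrC.
  by apply: shifted_rhs_const_le => //; exact: ltW.
pose U n := iter n T (fun=> M).
have U_bound n : (forall x, low x <= U n x <= M) /\ (forall x, U n.+1 x <= U n x).
  elim: n => [|n [IHb IHd]]; first by split=> x //=; rewrite lowM lexx.
  have Un0 x : 0 <= U n x by apply: le_trans (low_ge0 x) _; case/andP: (IHb x).
  have UnM x : U n x <= M by case/andP: (IHb x).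
  have b1 x : low x <= U n.+1 x <= M.
    apply/andP; split; last exact: le_trans (IHd x) (UnM x).
    apply: le_trans (T_low x) _; apply: T_le => // y.
    by case/andP: (IHb y).
  split=> // x; apply: T_le => // y.
  by apply: le_trans (low_ge0 y) _; case/andP: (b1 y).
pose us' x := limn (U ^~ x).
have U_cvg x : U n x @[n --> \oo] --> us' x.
  apply: nonincreasing_is_cvgn.
    by apply/nonincreasing_seqP => n; have [_] := U_bound n; exact.
  by exists (low x) => _ [n _ <-]; have [/(_ x)/andP[]] := U_bound n.
have us'_fix x : us' x = T us' x.
  have h1 : [sequence U n.+1 x]_n @ \oo --> us' x.
    by rewrite (cvg_shiftS (U ^~ x)); exact: U_cvg.
  have h2 : [sequence U n.+1 x]_n @ \oo --> T us' x.
    by apply: cvgM; [exact: cvg_cst | exact: shifted_rhs_cvg].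
  exact: cvg_unique h1 h2.
have us'_low x : low x <= us' x.
  apply: limr_ge; first exact: U_cvg.
  by apply: nearW => n; have [/(_ x)/andP[]] := U_bound n.
pose us x := if x \in Omega then us' x else 0.
have usE : {in Omega, us =1 us'} by move=> x xO; rewrite /us xO.
have us_bd : {in bd, forall x, us x = 0}.
  by move=> x /boundary_notin xb; rewrite /us xb.
exists us; split=> // x xO.
  have : K * us x = shifted_rhs K us x.
    rewrite (eq_shifted_rhs K xO usE) usE// {1}us'_fix /T mulrA divff ?mul1r//.
    by rewrite gt_eqF.
  rewrite shifted_rhsE//; lra.
rewrite usE//; apply: lt_le_trans (us'_low x).
by rewrite lowE// mulr_gt0// phi_gt0.
Qed.
End Dynamics.

(** * Long-time behaviour *)

Section Convergence.
Variables (R : realType) (V : finType) (E : rel V).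
Variables (w : V -> V -> R) (mu : V -> R) (Omega : {set V}) (a b : R).
Hypothesis hG : host_graph E w mu.
Hypothesis hOmega : simple_connected_subgraph E Omega.
Hypothesis hb : 0 < b.

Local Notation bd := (boundary E Omega).
Local Notation L := (laplacian E w mu Omega).
Local Notation equilibrium := (positive_equilibrium E w mu Omega a b).
Local Notation solution := (nonneg_global_solution E w mu Omega a b).
Local Notation barrier := (barrier E w mu Omega a b).

(** Writing m = 1 + D e with e = exp(-dt), the defect of m us in the equation is
    us D e (b us m - d), and rho and eps are lower bounds for us and m chosen so
    that b us m - d >= 0: the sign of the defect is that of D. *)
Lemma equilibrium_barrier (cmp : rel R) us (rho eps D : R) :
    (forall r, cmp r r) -> equilibrium us ->
    {in Omega, forall x, rho <= us x} -> 0 < rho -> 0 < eps ->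
    (forall t : R, 1 <= t -> eps <= 1 + D * expR (- (b * rho * eps) * t)) ->
    (forall p q r : R, 0 <= r -> p - q = D * r -> cmp p q) ->
  barrier cmp 1 (fun x t => (1 + D * expR (- (b * rho * eps) * t)) * us x).
Proof.
move=> cmp_refl hus rho_le rho0 eps0 m_ge cmpP; set d := b * rho * eps.
apply: (@separated_barrier R V E w mu Omega a b cmp 1
  (fun t => 1 + D * expR (- d * t)) (fun t => D * (- d * expR (- d * t))) us cmp_refl).
- exact: equilibrium_boundary hus.
- by move=> x xO; apply/ltW/(equilibrium_gt0 hus).
- by move=> t t1; apply: le_trans (m_ge t t1); exact: ltW.
- move=> t _; have h := is_derive_expM (- d) t.
  by apply: is_derive_eq; rewrite /GRing.scale/=; ring.
move=> x xO t t1.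
have Lx : L us x = - (us x * (a - b * us x)).
  by rewrite -(equilibrium_equation hus xO) opprK.
have m_eps := m_ge t (ltW t1); rewrite -/d in m_eps.
have r0 := equilibrium_gt0 hus xO; have r_rho := rho_le x xO.
have e0 : 0 < expR (- d * t) by exact: expR_gt0.
rewrite Lx; move: (expR _) (us x) e0 r0 r_rho m_eps => e r e0 r0 r_rho m_eps.
have k0 : 0 <= b * r * (1 + D * e) - d.
  rewrite subr_ge0 /d -(mulrA b rho) -(mulrA b r) ler_pM2l//.
  by apply: ler_pM => //; exact: ltW.
apply: (cmpP _ _ (e * (r * (b * r * (1 + D * e) - d)))); last by ring.
by apply: mulr_ge0; [exact: ltW | apply: mulr_ge0; [exact: ltW |]].
Qed.

Lemma expR_decay (d : R) : 0 < d -> expR (- d * t) @[t --> +oo] --> (0 : R).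
Proof.
move=> d0; have h : d * t @[t --> +oo] --> +oo by exact: gt0_cvgMry.
have := cvg_comp _ _ h (@cvgr_expR R).
by under eq_cvg do rewrite /= -mulNr.
Qed.

(** The barriers start at t = 1, where the solution is already positive on Omega
    and so lies between two positive multiples of us. *)
Theorem cvg_equilibrium us u0 u : equilibrium us -> solution u0 u ->
    {in Omega, forall x (t : R), 0 < t -> 0 < u x t} ->
  {in Omega, forall x, u x t @[t --> +oo] --> us x}.
Proof.
move=> hus hu u_gt0 x xO.
have us0 := equilibrium_gt0 hus.
have [rho /andP[rho0 _] rho_le] := finite_lower_bound us0.
have q0 : {in Omega, forall y, 0 < u y 1 / us y}.
  by move=> y yO; rewrite divr_gt0 ?us0// u_gt0.
have [eps /andP[eps0 eps1] eps_le] := finite_lower_bound q0.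
set d := b * rho * eps.
have d0 : 0 < d by rewrite /d !mulr_gt0.
have bar cmp (cmp_refl : reflexive cmp) : barrier cmp 1 u.
  exact: barrier_later ler01 (solution_barrier cmp_refl hu).
have expV : expR d * expR (- d * 1) = 1 by rewrite mulr1 expRxMexpNx_1.
pose C := \sum_(y in Omega) u y 1 / us y.
have C0 : 0 <= C by apply: sumr_ge0 => y yO; apply/ltW/q0.
have upper (t : R) : 1 <= t -> u x t <= (1 + C * expR d * expR (- d * t)) * us x.
  move=> t1.
  have D0 : 0 <= C * expR d by rewrite mulr_ge0 ?expR_ge0.
  apply: (comparison hG hb (bar <=%R lexx)
    (@equilibrium_barrier >=%R us rho eps (C * expR d)
    lexx hus rho_le rho0 eps0 _ _) _ xO t1).
  - by move=> s _; rewrite (le_trans eps1)// lerDl mulr_ge0 ?expR_ge0.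
  - by move=> p q r r0 e; change (q <= p); rewrite -subr_ge0 e mulr_ge0.
  - move=> y yO; rewrite -/d -mulrA expV mulr1 -ler_pdivrMr ?us0//.
    apply: le_trans (le_sum_nonneg (fun y yO => ltW (q0 y yO)) yO) _.
    by rewrite -/C lerDr ler01.
have lower (t : R) : 1 <= t -> (1 + (eps - 1) * expR d * expR (- d * t)) * us x <= u x t.
  move=> t1.
  have D0 : (eps - 1) * expR d <= 0 by rewrite mulr_le0_ge0 ?expR_ge0// subr_le0.
  apply: (comparison hG hb (@equilibrium_barrier <=%R us rho eps ((eps - 1) * expR d)
    lexx hus rho_le rho0 eps0 _ _) (bar >=%R lexx) _ xO t1).
  - move=> s s1; rewrite -/d.
    have h : expR d * expR (- d * s) <= 1.
      by rewrite -expRD -expR0 ler_expR mulNr subr_le0 ler_peMr// ltW.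
    have : (eps - 1) * 1 <= (eps - 1) * (expR d * expR (- d * s)).
      by rewrite ler_wnM2l// subr_le0.
    by rewrite mulrA; lra.
  - by move=> p q r r0 e; rewrite -subr_le0 e mulr_le0_ge0.
  - move=> y yO; rewrite -/d -mulrA expV mulr1 addrC subrK.
    by rewrite -ler_pdivlMr ?us0// eps_le.
have lim (D : R) : (1 + D * expR (- d * t)) * us x @[t --> +oo] --> us x.
  suff : (1 + D * expR (- d * t)) * us x @[t --> +oo] --> (1 + D * 0) * us x.
    by rewrite mulr0 addr0 mul1r.
  apply: cvgM; last exact: cvg_cst.
  apply: cvgD; first exact: cvg_cst.
  by apply: cvgM; [exact: cvg_cst | exact: expR_decay].
apply: (squeeze_cvgr _ (lim ((eps - 1) * expR d)) (lim (C * expR d))).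
near=> t; have t1 : 1 <= t by near: t; exact: nbhs_pinfty_ge.
by rewrite lower// upper.
Unshelve. all: by end_near. Qed.

(** Linear decay may be absent (a = l), so the barrier uses the quadratic term:
    m' = - beta m^2 with beta <= b phi. *)
Theorem cvg_extinction l u0 u : least_dirichlet_eigenvalue E w mu Omega l ->
    a <= l -> solution u0 u ->
  {in Omega, forall x, u x t @[t --> +oo] --> (0 : R)}.
Proof.
move=> /(principal_eigenfunction hG hOmega)[phi [phi0 phi_bd phi_eq]] al hu x xO.
have [rho /andP[rho0 _] rho_le] := finite_lower_bound phi0.
have q0 : {in Omega, forall y, 0 <= u y 0 / phi y}.
  move=> y yO; rewrite divr_ge0//; last exact/ltW/phi0.
  by apply: (solution_ge0 hu); rewrite /space_time yO lexx.
pose S := 1 + \sum_(y in Omega) u y 0 / phi y.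
have S0 : 0 < S by apply: ltr_pwDl => //; exact: sumr_ge0.
pose beta := b * rho; have beta0 : 0 < beta by exact: mulr_gt0.
pose B t := S^-1 + beta * t.
have B0 (t : R) : 0 <= t -> 0 < B t.
  by move=> t0; apply: ltr_wpDr; [rewrite mulr_ge0// ltW | rewrite invr_gt0].
have bar : barrier >=%R 0 (fun y t => (B t)^-1 * phi y).
  apply: (@separated_barrier R V E w mu Omega a b >=%R 0
    (fun t => (B t)^-1) (fun t => - beta * (B t)^-1 ^+ 2) phi lexx phi_bd).
  - by move=> y yO; apply/ltW/phi0.
  - by move=> t t0; rewrite invr_ge0 ltW// B0.
  - move=> t t0; have Bt : B t != 0 by rewrite gt_eqF// B0.
    have h : is_derive t (1 : R) B beta.
      by apply: is_derive_eq; rewrite /GRing.scale/=; ring.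
    have h2 := is_deriveV Bt h.
    by apply: is_derive_eq; rewrite /GRing.scale/= exprVn; ring.
  move=> y yO t t0.
  have Lphi : L phi y = - (l * phi y) by rewrite -phi_eq// opprK.
  have m0 : 0 < (B t)^-1 by rewrite invr_gt0 B0// ltW.
  have p0 := phi0 y yO; have p1 := rho_le y yO.
  rewrite Lphi /=; move: (B t)^-1 (phi y) m0 p0 p1 => m p m0 p0 p1.
  change (m * p * (a - b * (m * p)) <= - beta * m ^+ 2 * p - m * - (l * p)).
  rewrite -subr_ge0 (_ : _ - _ = m * p * (l - a) + m ^+ 2 * p * (b * (p - rho))).
    apply: addr_ge0; apply: mulr_ge0.
    - by rewrite mulr_ge0// ltW.
    - by rewrite subr_ge0.
    - by rewrite mulr_ge0 ?sqr_ge0// ltW.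
    - by rewrite mulr_ge0 ?subr_ge0// ltW.
  by rewrite /beta; ring.
have upper (t : R) : 0 <= t -> u x t <= (B t)^-1 * phi x.
  move=> t0.
  have low := @solution_barrier _ _ _ _ _ _ _ _ <=%R _ _ lexx hu.
  apply: (comparison hG hb low bar _ xO t0).
  move=> y yO; rewrite /B mulr0 addr0 invrK -ler_pdivrMr ?phi0//.
  by apply: le_trans (le_sum_nonneg q0 yO) _; rewrite lerDr ler01.
have lim : (B t)^-1 * phi x @[t --> +oo] --> (0 : R).
  rewrite -(mul0r (phi x)); apply: cvgM; last exact: cvg_cst.
  apply/gtr0_cvgV0.
    by near=> t; apply: B0; near: t; exact: nbhs_pinfty_ge.
  have h : beta * t @[t --> +oo] --> +oo by exact: gt0_cvgMry.
  apply: ger_cvgy h; apply: nearW => t.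
  by rewrite lerDr invr_ge0 ltW.
apply: (squeeze_cvgr _ (cvg_cst 0) lim).
near=> t; have t0 : 0 <= t by near: t; exact: nbhs_pinfty_ge.
by rewrite upper// andbT (solution_ge0 hu)// /space_time xO t0.
Unshelve. all: by end_near. Qed.

End Convergence.

Theorem theorem5p5 (R : realType) (V : finType) (E : rel V)
    (w : V -> V -> R) (mu : V -> R) (Omega : {set V})
    (a b : R) (u0 : V -> R)
    (hG : host_graph E w mu)
    (hOmega : simple_connected_subgraph E Omega)
    (hboundary : boundary E Omega != finset.set0)
    (hu0_ge0 : {in gclosure E Omega, forall x, 0 <= u0 x})
    (hu0_neq0 : exists2 x, x \in Omega & u0 x != 0)
    (ha : 0 < a) (hb : 0 < b) :
  exists u : V -> R -> R,
    [/\ nonneg_global_solution E w mu Omega a b u0 u,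
        forall v : V -> R -> R,
          nonneg_global_solution E w mu Omega a b u0 v ->
          forall x t, space_time E Omega x t -> v x t = u x t,
        forall us vs : V -> R,
          positive_equilibrium E w mu Omega a b us ->
          positive_equilibrium E w mu Omega a b vs ->
          {in gclosure E Omega, us =1 vs} &
        forall lambda1 : R,
          least_dirichlet_eigenvalue E w mu Omega lambda1 ->
          (lambda1 < a ->
             exists2 us : V -> R,
               positive_equilibrium E w mu Omega a b us &
               {uniform [set` gclosure E Omega],
                  (fun (t : R) (x : V) => u x t) @ +oo --> us}) /\
          (a <= lambda1 ->
             {uniform [set` Omega],
                (fun (t : R) (x : V) => u x t) @ +oo --> (fun=> 0 : R)})].
Proof.
have u0_ge0 x : x \in Omega -> 0 <= u0 x.
  by move=> xO; apply/hu0_ge0/sub_closure.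
pose M := a / b + \sum_(x in Omega) u0 x.
have sum0 : 0 <= \sum_(x in Omega) u0 x by exact: sumr_ge0.
have ab0 : 0 <= a / b by rewrite divr_ge0// ltW.
have aM : a <= b * M.
  by rewrite /M mulrDr mulrCA divff ?gt_eqF// mulr1 lerDl mulr_ge0// ltW.
have u0M : {in Omega, forall x, 0 <= u0 x <= M}.
  move=> x xO; rewrite u0_ge0//=.
  by apply: le_trans (le_sum_nonneg u0_ge0 xO) _; rewrite lerDr.
have [u [hu u_bound u_out]] := bounded_solution hG ha hb (addr_ge0 ab0 sum0) aM u0M.
exists u; split=> //.
- by move=> v; exact: (solution_unique hG hb hu).
- move=> us vs hus hvs x /closure_cases[xO|xb].
    apply/eqP; rewrite eq_le (equilibrium_le hG hb hus hvs)//=.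
    exact: (equilibrium_le hG hb hvs hus xO).
  by rewrite (equilibrium_boundary hus xb) (equilibrium_boundary hvs xb).
move=> l hl; split=> [la|al].
  have [us hus] := equilibrium_exists hG hOmega ha hb hl la.
  exists us => //; apply: cvg_uniform_finite => x /= /closure_cases[xO|xb].
    apply: (cvg_equilibrium hG hb hus hu) => //.
    apply: (solution_gt0 hG hOmega ha hb hu u_bound).
    have [x0 x0O ux0] := hu0_neq0; exists x0 => //.
    by rewrite lt_neqAle eq_sym ux0 u0_ge0.
  rewrite (equilibrium_boundary hus xb) (_ : u x = fun=> 0); first exact: cvg_cst.
  by apply/funext => t; rewrite u_out// (boundary_notin xb).
apply: cvg_uniform_finite => x /= xO.
exact: (cvg_extinction hG hOmega hb hl al hu xO).
Qed.
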